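(* Let $A\in\mathbb{R}^{n\times n}$ be a symmetric positive definite matrix, $B\in\mathbb{R}^{n\times n}$, $b\in\mathbb{R}^n$, and let $\Omega=\omega I\in\mathbb{R}^{n\times n}$ with $\omega>0$. Let $\mu_{\min}$ and $\mu_{\max}$ be the minimum and maximum eigenvalues of $A$, respectively, and let $\tau=\|B\|_2$. If $$\tau<\mu_{\min}\quad\text{and}\quad \omega>\frac{\mu_{\max}-\mu_{\min}}{2}+\tau,$$ then, for any initial vector $x^{(0)}\in\mathbb{R}^n$, the iteration sequence $\{x^{(k)}\}_{k=0}^{+\infty}$ generated by the SSMN iteration $$(\Omega+A)x^{(k+1)}=(\Omega-A)x^{(k)}+2\big(B|x^{(k)}|+b\big),\quad k=0,1,2,\ldots,$$ converges to the solution $x^{*}$ of the generalized absolute value equation $Ax-B|x|=b$.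
   Context: For $x=(x_1,\ldots,x_n)^T\in\mathbb{R}^n$, $|x|=(|x_1|,\ldots,|x_n|)^T$ is the componentwise absolute value. The generalized absolute value equation (GAVE) is $Ax-B|x|=b$ with given $A,B\in\mathbb{R}^{n\times n}$, $b\in\mathbb{R}^n$ and unknown $x\in\mathbb{R}^n$; $x^*$ denotes its solution. $I$ is the identity matrix. $\|\cdot\|_2$ is the Euclidean norm on vectors and the induced spectral norm on matrices. SSMN stands for shift splitting modified Newton-type; the iteration is the one displayed in the claim. *)

(* Defs.v *)
From HB Require Import structures.
From mathcomp Require Import all_boot all_order all_algebra.
From mathcomp Require Import all_classical all_reals all_analysis.

Set Implicit Arguments.
Unset Strict Implicit.
Unset Printing Implicit Defensive.

Import Order.TTheory GRing.Theory Num.Theory.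
Import numFieldNormedType.Exports.

Local Open Scope classical_set_scope.
Local Open Scope ring_scope.

Definition symmetric_posdef (R : realType) (n : nat) (A : 'M[R]_n) : Prop :=
  A \is symmetricmx /\
  forall x : 'cV[R]_n, x != 0 -> 0 < (x^T *m A *m x) 0 0.

(* [eigenvalue] ranges over R and is defined through row vectors; the row and
   column eigenvalues of a square matrix coincide. *)
Definition is_min_eigenvalue (R : realType) (n : nat) (A : 'M[R]_n) (mu : R) :
    Prop :=
  eigenvalue A mu /\ forall nu : R, eigenvalue A nu -> mu <= nu.

Definition is_max_eigenvalue (R : realType) (n : nat) (A : 'M[R]_n) (mu : R) :
    Prop :=
  eigenvalue A mu /\ forall nu : R, eigenvalue A nu -> nu <= mu.

(* The norm `|x| that MathComp-Analysis puts on matrices is the maximum norm,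
   hence these definitions. *)
Definition norm2 (R : realType) (n : nat) (x : 'cV[R]_n) : R :=
  Num.sqrt (\sum_(i < n) x i 0 ^+ 2).

(* The unit ball, unlike the unit sphere, is nonempty also for n = 0. *)
Definition spectral_norm (R : realType) (n : nat) (B : 'M[R]_n) : R :=
  sup [set norm2 (B *m x) | x in [set x : 'cV[R]_n | norm2 x <= 1]].

Definition abs_vec (R : realType) (n : nat) (x : 'cV[R]_n) : 'cV[R]_n :=
  \col_(i < n) `|x i 0|.

Definition gave_solution (R : realType) (n : nat) (A B : 'M[R]_n)
    (b x : 'cV[R]_n) : Prop :=
  A *m x - B *m abs_vec x = b.

Definition ssmn_sequence (R : realType) (n : nat) (Omega A B : 'M[R]_n)
    (b : 'cV[R]_n) (x : nat -> 'cV[R]_n) : Prop :=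
  forall k : nat,
    (Omega + A) *m x k.+1 =
    (Omega - A) *m x k + 2%:R *: (B *m abs_vec (x k) + b).

(* Main.v *)
Require Import Defs.
From HB Require Import structures.
From mathcomp Require Import all_boot all_order all_algebra.
From mathcomp Require Import all_classical all_reals all_analysis.
From mathcomp Require Import ring lra.

Set Implicit Arguments.
Unset Strict Implicit.
Unset Printing Implicit Defensive.

Import Order.TTheory GRing.Theory Num.Theory.
Import numFieldNormedType.Exports.

Local Open Scope classical_set_scope.
Local Open Scope ring_scope.

(** Write the iteration as [x_{k+1} = G x_k].  The fixed points of [G] are the
    solutions of [A x - B |x| = b], so it suffices that [G] is a contraction of
    the Euclidean norm.  As [x |-> |x|] is nonexpansive, the factor of [G] is
    at most
      [|(omega + A)^-1 (omega - A)| + 2 tau |(omega + A)^-1|].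
    The second norm is at most [1 / (omega + mu_min)].  The first is the
    maximum of [|omega - mu| / (omega + mu)] over the spectrum of [A], hence
    over its two ends.  At [mu = mu_min <= omega] the resulting condition is
    [tau < mu_min]; at [mu = mu_max] it is
    [tau (omega + mu_max) < omega (omega + mu_min)], which the lower bound on
    [omega] implies.

    No diagonalization of [A] is used; only inequalities between quadratic
    forms are.
    - [rayleigh_ge] and [rayleigh_le] bound the form of [A] by its extremal
      eigenvalues: the infimum of the Rayleigh quotient is an eigenvalue,
      because a semidefinite form of an invertible matrix is coercive.
    - [norm2_cayley_le] bounds [(omega + A)^-1 (omega - A)].  The two ends of
      the spectrum are treated at once by enlarging [[mu_min, mu_max]] to an
      interval [[m', M']] with [m' M' = omega^2], at both ends of which
      [|omega - mu| / (omega + mu)] is equal to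
      [(omega - m') / (omega + m')].  That some such interval leaves the
      factor below 1 is [exists_lower_spectral_bound].
    - [norm2_contraction_fixpoint] passes from the Euclidean norm to the
      maximum norm by taking a high iterate of [G]. *)

(** * The Euclidean inner product *)

Definition dot (R : realType) (n : nat) (x y : 'cV[R]_n) : R :=
  \sum_(i < n) x i 0 * y i 0.

Section Dot.
Context {R : realType} {n : nat}.
Implicit Types (x y z : 'cV[R]_n) (S A : 'M[R]_n) (a c m M : R).

Lemma dotC x y : dot x y = dot y x.
Proof. by apply: eq_bigr => i _; rewrite mulrC. Qed.

Lemma dotDl x y z : dot (x + y) z = dot x z + dot y z.
Proof. by rewrite -big_split; apply: eq_bigr => i _; rewrite mxE mulrDl. Qed.

Lemma dotDr x y z : dot x (y + z) = dot x y + dot x z.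
Proof. by rewrite dotC dotDl !(dotC _ x). Qed.

Lemma dotZl a x y : dot (a *: x) y = a * dot x y.
Proof. by rewrite mulr_sumr; apply: eq_bigr => i _; rewrite mxE mulrA. Qed.

Lemma dotZr a x y : dot x (a *: y) = a * dot x y.
Proof. by rewrite dotC dotZl dotC. Qed.

Lemma dotNl x y : dot (- x) y = - dot x y.
Proof. by rewrite -scaleN1r dotZl mulN1r. Qed.

Lemma dotNr x y : dot x (- y) = - dot x y.
Proof. by rewrite dotC dotNl dotC. Qed.

Definition dotE := (dotDl, dotDr, dotNl, dotNr, dotZl, dotZr).

Lemma dot_ge0 x : 0 <= dot x x.
Proof. by apply: sumr_ge0 => i _; rewrite -expr2 sqr_ge0. Qed.

Lemma dot_eq0 x : dot x x = 0 -> x = 0.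
Proof.
move=> /eqP; rewrite psumr_eq0; last by move=> i _; rewrite -expr2 sqr_ge0.
move=> /allP x0; apply/colP => i; rewrite mxE; apply/eqP.
by have := x0 i (mem_index_enum i); rewrite mulf_eq0 orbb.
Qed.

Lemma dot_symmetricmx A : A \is symmetricmx ->
  forall x y, dot (A *m x) y = dot x (A *m y).
Proof.
move=> /is_hermitianmxP; rewrite expr0 scale1r map_mx_id // => AT x y.
have dotmx u v : dot u v = (u^T *m v) 0 0.
  by rewrite mxE; apply: eq_bigr => i _; rewrite mxE.
by rewrite !dotmx trmx_mul -AT mulmxA.
Qed.

(** Evaluate the quadratic at its minimizer [- b / c].  For [c = 0] it is
    affine, and is negative somewhere unless [b = 0]. *)
Lemma sqr_le_of_quadratic_ge0 (a b c : R) : 0 <= c ->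
  (forall t, 0 <= a + 2%:R * t * b + t ^+ 2 * c) -> b ^+ 2 <= a * c.
Proof.
move=> c0 q; case: (ltrP 0 c) => [c_gt0|c_le0].
  have := q (- b / c); have -> : a + 2%:R * (- b / c) * b + (- b / c) ^+ 2 * c
    = (a * c - b ^+ 2) / c by field; rewrite gt_eqF.
  by rewrite pmulr_lge0 ?invr_gt0 // subr_ge0.
have c_eq0 : c = 0 by apply/eqP; rewrite eq_le c_le0 c0.
move: q; rewrite c_eq0 => q.
have [->|b0] := eqVneq b 0; first by rewrite mulr0 expr0n.
have := q (- (a + 1) / (2%:R * b)).
have -> : a + 2%:R * (- (a + 1) / (2%:R * b)) * b
    + (- (a + 1) / (2%:R * b)) ^+ 2 * 0 = -1 by field.
lra.
Qed.

(** The proof of the Cauchy-Schwarz inequality uses only that the form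
    [dot x (S y)] is symmetric and positive semidefinite.  [psd_unit_coercive]
    applies it to a form whose definiteness is what has to be proved. *)
Lemma cauchy_schwarz_psd S x y :
  (forall x y, dot (S *m x) y = dot x (S *m y)) ->
  (forall x, 0 <= dot x (S *m x)) ->
  dot x (S *m y) ^+ 2 <= dot x (S *m x) * dot y (S *m y).
Proof.
move=> symS S0; apply: sqr_le_of_quadratic_ge0 => // t.
have := S0 (x + t *: y); rewrite mulmxDr -scalemxAr !dotE.
by rewrite -(symS y x) (dotC (S *m y)); lra.
Qed.

Lemma cauchy_schwarz x y : dot x y ^+ 2 <= dot x x * dot y y.
Proof.
have := @cauchy_schwarz_psd 1%:M x y; rewrite !mul1mx; apply => u.
  by move=> v; rewrite !mul1mx.
by rewrite mul1mx dot_ge0.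
Qed.

(** Every matrix is a bounded operator; the constant is its squared Frobenius
    norm. *)
Lemma dot_mulmx_bound A : exists2 C, 0 <= C &
  forall x, dot (A *m x) (A *m x) <= C * dot x x.
Proof.
exists (\sum_i dot (row i A)^T (row i A)^T) => [|x].
  by apply: sumr_ge0 => i _; exact: dot_ge0.
rewrite mulr_suml; apply: ler_sum => i _; rewrite -expr2.
have -> : (A *m x) i 0 = dot (row i A)^T x.
  by rewrite mxE; apply: eq_bigr => j _; rewrite !mxE.
exact: cauchy_schwarz.
Qed.

(** * Extremal eigenvalues of a symmetric matrix *)

(** A positive semidefinite form of an invertible matrix is coercive:
    Cauchy-Schwarz for the form itself, applied to [x] and [S x], bounds
    [|S x|^2] by a multiple of the form at [x], and invertibility bounds [|x|]
    by a multiple of [|S x|]. *)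
Lemma psd_unit_coercive S :
  (forall x y, dot (S *m x) y = dot x (S *m y)) ->
  (forall x, 0 <= dot x (S *m x)) -> S \in unitmx ->
  exists2 e, 0 < e & forall x, e * dot x x <= dot x (S *m x).
Proof.
move=> symS S0 unitS.
have [C C0 bS] := dot_mulmx_bound S.
have [C' C'0 bS'] := dot_mulmx_bound (invmx S).
set K := (1 + C') * (1 + C).
have K0 : 0 < K by rewrite /K; nra.
exists K^-1 => [|x]; first by rewrite invr_gt0.
rewrite mulrC ler_pdivrMr //.
set y := S *m x; set f := dot x y; set N := dot y y.
have xN : dot x x <= C' * N by have := bS' y; rewrite mulKmx.
have f0 : 0 <= f := S0 x.
have N0 : 0 <= N := dot_ge0 y.
have yS : dot y (S *m y) <= (1 + C) * N.
  have := dot_ge0 (y - S *m y); rewrite !dotE (dotC _ y).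
  by have := bS y; have := S0 y; rewrite -/N; nra.
have NN : N ^+ 2 <= f * ((1 + C) * N).
  apply: (@le_trans _ _ (f * dot y (S *m y))); last exact: ler_wpM2l.
  by have := cauchy_schwarz_psd x y symS S0; rewrite -(symS x y) -/y -/N.
have Nf : N <= (1 + C) * f.
  have [->|Nn] := eqVneq N 0; first by rewrite mulr_ge0 // addr_ge0.
  have Ngt : 0 < N by rewrite lt_def Nn.
  by rewrite -(ler_pM2r Ngt) -expr2; apply: le_trans NN _; rewrite mulrCA mulrA.
apply: (le_trans xN); apply: (@le_trans _ _ (C' * ((1 + C) * f))).
  exact: ler_wpM2l.
by rewrite /K; nra.
Qed.

Lemma eigenvalue_unitmx A a : ~~ eigenvalue A a = (A - a%:M \in unitmx).
Proof. by rewrite /eigenvalue negbK /eigenspace kermx_eq0 row_free_unit. Qed.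

(** The infimum [s] of the Rayleigh quotient is an eigenvalue: [A - s] is
    positive semidefinite, and were it invertible, it would be coercive, so
    that the quotient would stay above some [s + e] with [e > 0]. *)
Lemma rayleigh_ge A m :
  (forall x y, dot (A *m x) y = dot x (A *m y)) ->
  (forall nu, eigenvalue A nu -> m <= nu) ->
  forall x, m * dot x x <= dot x (A *m x).
Proof.
move=> symA hm x0.
have [->|/negP x0n] := eqVneq x0 0.
  by rewrite mulmx0 -(scale0r 0) !dotE !mul0r mulr0.
have dgt x : x <> 0 -> 0 < dot x x.
  by move=> xn; rewrite lt_def dot_ge0 andbT; apply/eqP => /dot_eq0.
pose E := [set c : R | forall x, c * dot x x <= dot x (A *m x)].
have ubE x : x <> 0 -> ubound E (dot x (A *m x) / dot x x).
  by move=> /dgt xn c Ec; rewrite ler_pdivlMr.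
have E0 : E !=set0.
  have [C C0 bA] := dot_mulmx_bound A.
  exists (- (1 + C)) => x /=.
  have := dot_ge0 (x + A *m x); rewrite !dotE (dotC _ x).
  by have := bA x; have := dot_ge0 x; nra.
have hE : has_sup E.
  by split=> //; exists (dot x0 (A *m x0) / dot x0 x0); apply: ubE => /eqP.
have sE : E (sup E).
  move=> x; have [->|/eqP xn] := eqVneq x 0.
    by rewrite mulmx0 -(scale0r 0) !dotE !mul0r mulr0.
  by rewrite -ler_pdivlMr ?dgt //; apply: ge_sup => //; exact: ubE.
suff /hm ms : eigenvalue A (sup E).
  by apply: le_trans (sE x0); rewrite ler_wpM2r // dot_ge0.
apply: contraT; rewrite eigenvalue_unitmx => uS.
have SE x : (A - (sup E)%:M) *m x = A *m x - sup E *: x.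
  by rewrite mulmxBl mul_scalar_mx.
have [||e e0 coerc] := psd_unit_coercive _ _ uS.
- by move=> x y; rewrite !SE !dotE symA.
- by move=> x; rewrite SE !dotE subr_ge0; exact: sE.
have : E (sup E + e).
  by move=> x; have := coerc x; rewrite SE !dotE; lra.
move=> /(sup_upper_bound hE); lra.
Qed.

Lemma rayleigh_le A M :
  (forall x y, dot (A *m x) y = dot x (A *m y)) ->
  (forall nu, eigenvalue A nu -> nu <= M) ->
  forall x, dot x (A *m x) <= M * dot x x.
Proof.
move=> symA hM x; rewrite -lerN2 -mulNr -dotNr -mulNmx.
apply: rayleigh_ge => [y z|nu /eigenvalueP[v vA v0]].
  by rewrite !mulNmx !dotE symA.
rewrite lerNl; apply: hM; apply/eigenvalueP; exists v => //.
by rewrite scaleNr -vA mulmxN opprK.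
Qed.

End Dot.

(** * The Euclidean norm and the spectral norm *)

Section Norm2.
Context {R : realType} {n : nat}.
Implicit Types (x y : 'cV[R]_n) (B : 'M[R]_n) (a c : R).

Lemma norm2_ge0 x : 0 <= norm2 x.
Proof. exact: sqrtr_ge0. Qed.

Lemma norm2E x : norm2 x = Num.sqrt (dot x x).
Proof. by congr Num.sqrt; apply: eq_bigr => i _; rewrite expr2. Qed.

Lemma sqr_norm2 x : norm2 x ^+ 2 = dot x x.
Proof. by rewrite norm2E sqr_sqrtr // dot_ge0. Qed.

Lemma norm2_eq0 x : norm2 x = 0 -> x = 0.
Proof. by move=> x0; apply: dot_eq0; rewrite -sqr_norm2 x0 expr0n. Qed.

Lemma norm2Z a x : norm2 (a *: x) = `|a| * norm2 x.
Proof.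
by rewrite !norm2E !dotE mulrA -expr2 sqrtrM ?sqr_ge0 // sqrtr_sqr.
Qed.

Lemma norm2_0 : norm2 (0 : 'cV[R]_n) = 0.
Proof. by rewrite -(scale0r 0) norm2Z normr0 mul0r. Qed.

Lemma norm2_leM x y c : 0 <= c ->
  (norm2 x <= c * norm2 y) = (dot x x <= c ^+ 2 * dot y y).
Proof.
move=> c0; rewrite -!sqr_norm2 -exprMn ler_sqr // nnegrE ?norm2_ge0 //.
by rewrite mulr_ge0 // norm2_ge0.
Qed.

Lemma dot_le_norm2 x y : dot x y <= norm2 x * norm2 y.
Proof.
apply: le_trans (ler_norm _) _.
rewrite -ler_sqr ?nnegrE ?mulr_ge0 ?norm2_ge0 //.
by rewrite real_normK ?num_real // exprMn !sqr_norm2 cauchy_schwarz.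
Qed.

Lemma ler_norm2D x y : norm2 (x + y) <= norm2 x + norm2 y.
Proof.
rewrite -ler_sqr ?nnegrE ?addr_ge0 ?norm2_ge0 // sqrrD !sqr_norm2 !dotE.
by rewrite (dotC y x); have := dot_le_norm2 x y; lra.
Qed.

Lemma mx_norm_le_norm2 x : `|x| <= norm2 x.
Proof.
rewrite [leLHS]/Num.norm /= mx_normrE; apply/bigmax_leP.
split; first exact: norm2_ge0.
move=> [i j] _ /=; rewrite (ord1 j) -ler_sqr ?nnegrE ?norm2_ge0 //.
rewrite sqr_norm2 /dot (bigD1 i) //= real_normK ?num_real // -expr2 lerDl.
by apply: sumr_ge0 => k _; rewrite -expr2 sqr_ge0.
Qed.

Lemma norm2_le_mx_norm x : norm2 x <= n%:R * `|x|.
Proof.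
rewrite -ler_sqr ?nnegrE ?mulr_ge0 ?norm2_ge0 // sqr_norm2.
have xi i : `|x i 0| <= `|x|.
  by rewrite [leRHS]/Num.norm /= mx_normrE; apply: (le_bigmax _ _ (i, 0)).
apply: (@le_trans _ _ (\sum_(i < n) `|x| ^+ 2)).
  apply: ler_sum => i _; rewrite -expr2 -real_normK ?num_real //.
  by rewrite ler_sqr ?nnegrE.
rewrite sumr_const card_ord exprMn -[leLHS]mulr_natl ler_wpM2r ?sqr_ge0 //.
by rewrite -natrX ler_nat -mulnn; case: (n) => // k; rewrite leq_pmulr.
Qed.

Lemma norm2_abs_vecB x y : norm2 (abs_vec x - abs_vec y) <= norm2 (x - y).
Proof.
rewrite ler_sqrt; last by apply: sumr_ge0 => i _; exact: sqr_ge0.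
apply: ler_sum => i _; rewrite !mxE -[leLHS]real_normK ?num_real //.
by rewrite -[leRHS]real_normK ?num_real // ler_sqr ?nnegrE // ler_dist_dist.
Qed.

Lemma has_sup_spectral_norm B :
  has_sup [set norm2 (B *m x) | x in [set x : 'cV[R]_n | norm2 x <= 1]].
Proof.
split; first by exists (norm2 (B *m 0)), 0; rewrite //= norm2_0.
have [C C0 bB] := dot_mulmx_bound B.
exists (Num.sqrt C) => _ [x /= x1 <-].
apply: (@le_trans _ _ (Num.sqrt C * norm2 x)).
  by rewrite norm2_leM ?sqrtr_ge0 // sqr_sqrtr.
by rewrite ler_piMr // sqrtr_ge0.
Qed.

Lemma spectral_norm_ge0 B : 0 <= spectral_norm B.
Proof.
apply: (sup_upper_bound (has_sup_spectral_norm B)).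
by exists 0; rewrite /= ?norm2_0 // mulmx0 norm2_0.
Qed.

Lemma norm2_mulmx_le B x : norm2 (B *m x) <= spectral_norm B * norm2 x.
Proof.
have [->|/eqP xn] := eqVneq x 0; first by rewrite mulmx0 norm2_0 mulr0.
have x0 : 0 < norm2 x.
  by rewrite lt_def norm2_ge0 andbT; apply/eqP => /norm2_eq0.
have xV : `|(norm2 x)^-1| = (norm2 x)^-1 by rewrite ger0_norm ?invr_ge0 ?ltW.
rewrite -ler_pdivrMr // mulrC; apply: sup_upper_bound.
  exact: has_sup_spectral_norm.
exists ((norm2 x)^-1 *: x); first by rewrite /= norm2Z xV mulVf // gt_eqF.
by rewrite -scalemxAr norm2Z xV.
Qed.

End Norm2.

(** * Contractions of the Euclidean norm *)

(** Banach's theorem asks for the join of the normed and the complete structure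
    of matrices. *)
HB.instance Definition _ (R : realType) (m n : nat) := Complete.on 'M[R]_(m, n).

Section Contraction.
Context {R : realType} {n : nat}.
Variables (G : 'cV[R]_n -> 'cV[R]_n) (q : R).
Hypothesis q_ge0 : 0 <= q.
Hypothesis q_lt1 : q < 1.
Hypothesis contrG : forall x y, norm2 (G x - G y) <= q * norm2 (x - y).

Lemma norm2_iter_contraction k x y :
  norm2 (iter k G x - iter k G y) <= q ^+ k * norm2 (x - y).
Proof.
elim: k => [|k IHk]; first by rewrite expr0 mul1r.
rewrite !iterS exprS -mulrA; apply: le_trans (contrG _ _) _.
by rewrite ler_wpM2l.
Qed.

Lemma expr_mul_cvg0 c : (q ^+ k * c) @[k --> \oo] --> 0.
Proof.
have -> : (fun k => q ^+ k * c) = geometric c q.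
  by apply/funext => k; rewrite mulrC.
by apply: cvg_geometric; rewrite ger0_norm.
Qed.

(** Banach's theorem is applied in the maximum norm, for which [G] need not be
    a contraction; by equivalence of norms, some iterate of [G] is one.  Its
    fixed point [p] is fixed by [G] too, since it is unique and [G p] is
    another one. *)
Lemma norm2_contraction_fixpoint : exists p, G p = p.
Proof.
have [N qN] : exists N, q ^+ N * n%:R < 2%:R^-1.
  have /cvgrPdist_lt/(_ 2%:R^-1) := expr_mul_cvg0 n%:R.
  rewrite invr_gt0 ltr0n => /(_ isT) [N _ /(_ N)] /=.
  rewrite leqnn sub0r normrN => /(_ isT) qN; exists N.
  by apply: le_lt_trans qN; exact: ler_norm.
pose F : {fun [set: 'cV[R]_n] >-> [set: 'cV[R]_n]} :=
  [fun of totalfun (iter N G)].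
have ctrF : is_contraction F.
  exists 2%:R^-1%:nng; split => /=; first by rewrite invf_lt1 // ltr1n.
  move=> [x y] _ /=; apply: le_trans (mx_norm_le_norm2 _) _.
  apply: le_trans (norm2_iter_contraction _ _ _) _.
  apply: (@le_trans _ _ (q ^+ N * (n%:R * `|x - y|))).
    by rewrite ler_wpM2l ?exprn_ge0 // norm2_le_mx_norm.
  by rewrite mulrA ler_wpM2r // ltW.
have [|p _ Fp] := banach_fixed_point ctrF closedT; first by exists 0.
exists p; apply: (contraction_fixpoint_unique ctrF) => //.
by rewrite -[RHS]/(iter N G (G p)) -iterSr iterS -[iter N G p]Fp.
Qed.

Lemma norm2_contraction_cvg p (x : nat -> 'cV[R]_n) :
  G p = p -> (forall k, x k.+1 = G (x k)) -> x k @[k --> \oo] --> p.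
Proof.
move=> Gp xS; have xk k : norm2 (x k - p) <= q ^+ k * norm2 (x 0%N - p).
  elim: k => [|k IHk]; first by rewrite expr0 mul1r.
  rewrite xS -{1}Gp exprS -mulrA; apply: le_trans (contrG _ _) _.
  by rewrite ler_wpM2l.
apply/cvgrPdist_lt => e e0.
have /cvgrPdist_lt/(_ _ e0) := expr_mul_cvg0 (norm2 (x 0%N - p)).
apply: filterS => k; rewrite sub0r normrN => qk.
rewrite distrC; apply: le_lt_trans (mx_norm_le_norm2 _) _.
by apply: le_lt_trans (xk k) _; apply: le_lt_trans qk; exact: ler_norm.
Qed.

End Contraction.

(** * The shift-splitting step *)

(** The number [m'] is the left end of the enlarged spectral interval, whose
    right end is [omega ^+ 2 / m'].  The last inequality says that the
    contraction factor [(omega - m') / (omega + m') + 2 tau / (omega + m)] is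
    less than 1.  The lower bound [t = tau omega / (omega + m - tau)] for [m']
    is where that inequality becomes an equality; it lies below each of the
    three upper bounds on [m']. *)
Lemma exists_lower_spectral_bound (R : realType) (m M omega tau : R) :
  0 <= tau -> tau < m -> m <= M -> (M - m) / 2%:R + tau < omega ->
  exists m', [/\ 0 < m', m' <= m, m' < omega, m' * M <= omega ^+ 2
    & tau * (omega + m') < m' * (omega + m)].
Proof.
move=> tau0 tau_m mM omega_gt.
have omega0 : 0 < omega by lra.
have M0 : 0 < M by lra.
have D0 : 0 < omega + m - tau by lra.
pose t := tau * omega / (omega + m - tau).
pose u := Num.min m (Num.min omega (omega ^+ 2 / M)).
have t0 : 0 <= t by rewrite divr_ge0 ?mulr_ge0 // ltW.
have tD : t * (omega + m - tau) = tau * omega by rewrite /t divfK // gt_eqF.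
have tu : t < u.
  rewrite /u !lt_min /t !ltr_pdivrMr //; apply/and3P; split.
  - by nra.
  - by nra.
  - rewrite mulrAC ltr_pdivlMr // -subr_gt0.
    (* With [d = M - m], this is omega times
       [(omega - d / 2 - tau) (omega + m) + d / 2 (omega + m - 2 tau)],
       so that the lower bound on [omega] makes it positive. *)
    have -> : omega ^+ 2 * (omega + m - tau) - tau * omega * M =
      omega * ((omega - ((M - m) / 2%:R + tau)) * (omega + m)
               + (M - m) / 2%:R * (omega + m - 2%:R * tau)) by field.
    rewrite mulr_gt0 // ltr_wpDr //; last by rewrite mulr_gt0 //; lra.
    by rewrite mulr_ge0 //; lra.
have [um uo uM] : [/\ u <= m, u <= omega & u * M <= omega ^+ 2].
  rewrite -ler_pdivlMr //.
  by split; rewrite /u !ge_min lexx ?orbT.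
exists ((t + u) / 2%:R); split; [lra|lra|lra| |].
  by apply: le_trans uM; rewrite ler_pM2r //; lra.
have : t * (omega + m - tau) < (t + u) / 2%:R * (omega + m - tau).
  by rewrite ltr_pM2r //; lra.
by rewrite tD; lra.
Qed.

Section ShiftSplitting.
Context {R : realType} {n : nat}.
Variables (A : 'M[R]_n) (omega : R).
Hypothesis symA : forall x y : 'cV[R]_n, dot (A *m x) y = dot x (A *m y).
Hypothesis omega_gt0 : 0 < omega.

(** This is the operator inequality [(A - m) (M - A) >= 0].  A product of
    commuting semidefinite operators [P] and [Q] is recovered from forms
    alone: [(P + Q) P Q = P Q P + Q P Q], and here [P + Q = M - m] is a
    positive scalar. *)
Lemma dot_sqr_le_of_spectrum (m M : R) : m < M ->
  (forall x, m * dot x x <= dot x (A *m x)) ->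
  (forall x, dot x (A *m x) <= M * dot x x) ->
  forall x, dot (A *m x) (A *m x) + m * M * dot x x
    <= (m + M) * dot x (A *m x).
Proof.
move=> mM lbA ubA x.
rewrite -subr_ge0 -(pmulr_rge0 _ (_ : 0 < M - m)) ?subr_gt0 //.
have := lbA (M *: x - A *m x); have := ubA (A *m x - m *: x).
rewrite !mulmxBr -!scalemxAr !dotE.
rewrite -(symA x (A *m x)) (dotC (A *m x) x).
by lra.
Qed.

(** The Cayley transform of [A].  Enlarging the spectral interval so that
    [m * M = omega ^+ 2] makes both of its ends contribute the same value
    [(omega - m) / (omega + m)] to the bound on
    [|omega - mu| / (omega + mu)]. *)
Lemma norm2_cayley_le (m M : R) : 0 < m -> m < omega -> m * M = omega ^+ 2 ->
  (forall x, m * dot x x <= dot x (A *m x)) ->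
  (forall x, dot x (A *m x) <= M * dot x x) ->
  forall w, norm2 (omega *: w - A *m w)
    <= (omega - m) / (omega + m) * norm2 (omega *: w + A *m w).
Proof.
move=> m0 m_omega mM lbA ubA w.
have mltM : m < M.
  rewrite -(ltr_pM2l m0) mM -expr2 ltr_sqr // nnegrE; exact: ltW.
have om0 : 0 < omega + m by lra.
rewrite norm2_leM; last by rewrite divr_ge0 //; lra.
rewrite expr_div_n mulrAC ler_pdivlMr ?exprn_gt0 // !dotE (dotC _ w).
have := dot_sqr_le_of_spectrum mltM lbA ubA w; rewrite mM.
set s := dot w w; set a := dot w _; set b := dot _ _ => S_le.
have : m * (b + omega ^+ 2 * s) <= (m ^+ 2 + omega ^+ 2) * a.
  have -> : (m ^+ 2 + omega ^+ 2) * a = m * ((m + M) * a) by rewrite -mM; ring.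
  by rewrite ler_pM2l.
rewrite -(ler_pM2l (_ : 0 < 4%:R * omega)); last by lra.
lra.
Qed.

Lemma addmx_shift_unitmx (m : R) : 0 < m ->
  (forall nu, eigenvalue A nu -> m <= nu) -> omega%:M + A \in unitmx.
Proof.
move=> m0 hm.
have -> : omega%:M + A = A - (- omega)%:M by rewrite raddfN opprK addrC.
rewrite -eigenvalue_unitmx.
apply/negP => /hm /(lt_le_trans m0).
by rewrite oppr_gt0 ltNge ltW.
Qed.

(** Dividing the step equation by [omega + A] gives
    [d' = (omega + A)^-1 (omega - A) d + 2 (omega + A)^-1 e]; the two terms
    of the factor bound these two operators, the second through
    [omega + A >= omega + m]. *)
Lemma norm2_shift_splitting_le (m m' M tau : R) (d d' e : 'cV[R]_n) :
  0 < m' -> m' <= m -> m' < omega -> m' * M <= omega ^+ 2 ->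
  (forall nu, eigenvalue A nu -> m <= nu) ->
  (forall nu, eigenvalue A nu -> nu <= M) ->
  (omega%:M + A) *m d' = (omega%:M - A) *m d + 2%:R *: e ->
  norm2 e <= tau * norm2 d ->
  norm2 d' <= ((omega - m') / (omega + m') + 2%:R * tau / (omega + m))
    * norm2 d.
Proof.
move=> m'0 m'm m'o m'M hm hM d'E e_le.
have m0 : 0 < m by exact: lt_le_trans m'm.
have uA := addmx_shift_unitmx m0 hm.
have lbA := rayleigh_ge symA hm.
pose w := invmx (omega%:M + A) *m d.
have dE : d = (omega%:M + A) *m w by rewrite mulKVmx.
pose u := (omega%:M - A) *m w; pose v : 'cV[R]_n := d' - u.
have vE : (omega%:M + A) *m v = 2%:R *: e.
  rewrite mulmxBr d'E dE /u !mulmxA.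
  have -> : (omega%:M + A) *m (omega%:M - A) = (omega%:M - A) *m (omega%:M + A).
    rewrite mulmxDl mulmxBl !mulmxBr !mulmxDr -(scalar_mxC omega A).
    by rewrite addrA subrK opprD addrA addrK.
  by rewrite addrC addKr.
have d'uv : d' = u + v by rewrite addrC subrK.
clearbody v.
have v_le : norm2 v <= 2%:R * tau / (omega + m) * norm2 d.
  have om0 : 0 < omega + m by lra.
  rewrite mulrAC ler_pdivlMr //.
  have [v0|vn] := eqVneq (norm2 v) 0.
    by have e0 := le_trans (norm2_ge0 e) e_le; rewrite v0 mul0r -mulrA mulr_ge0.
  have vgt : 0 < norm2 v by rewrite lt_def vn norm2_ge0.
  rewrite -(ler_pM2l vgt).
  have := congr1 (dot v) vE.
  rewrite mulmxDl mul_scalar_mx !dotE.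
  have := lbA v; have := dot_le_norm2 v e; rewrite -sqr_norm2.
  have : norm2 v * norm2 e <= norm2 v * (tau * norm2 d) by rewrite ler_pM2l.
  lra.
have u_le : norm2 u <= (omega - m') / (omega + m') * norm2 d.
  rewrite dE /u mulmxBl mulmxDl mul_scalar_mx.
  apply: (@norm2_cayley_le m' (omega ^+ 2 / m')) => //.
  - by rewrite mulrC divfK // gt_eqF.
  - by move=> x; apply: le_trans (lbA x); rewrite ler_wpM2r ?dot_ge0.
  - move=> x; apply: le_trans (rayleigh_le symA hM x) _.
    by rewrite ler_wpM2r ?dot_ge0 // ler_pdivlMr // mulrC.
by rewrite d'uv mulrDl; apply: le_trans (ler_norm2D _ _) _; rewrite lerD.
Qed.

End ShiftSplitting.

Definition ssmn_map (R : realType) (n : nat) (A B : 'M[R]_n) (omega : R)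
    (b x : 'cV[R]_n) : 'cV[R]_n :=
  invmx (omega%:M + A) *m
    ((omega%:M - A) *m x + 2%:R *: (B *m abs_vec x + b)).

Lemma ssmn_mapP (R : realType) (n : nat) (A B : 'M[R]_n) (omega : R)
    (b x y : 'cV[R]_n) : omega%:M + A \in unitmx ->
  (omega%:M + A) *m y = (omega%:M - A) *m x + 2%:R *: (B *m abs_vec x + b) <->
  y = ssmn_map A B omega b x.
Proof.
move=> uA; rewrite /ssmn_map; split=> [<-|->]; first by rewrite mulKmx.
by rewrite mulKVmx.
Qed.

Lemma gave_solution_fixpoint (R : realType) (n : nat) (A B : 'M[R]_n)
    (omega : R) (b x : 'cV[R]_n) : omega%:M + A \in unitmx ->
  gave_solution A B b x <-> ssmn_map A B omega b x = x.
Proof.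
move=> uA; rewrite /gave_solution; split=> [Axb|/esym/(ssmn_mapP _ _ _ _ uA)].
  apply/esym/ssmn_mapP => //.
  have -> : B *m abs_vec x + b = A *m x by rewrite -Axb addrC subrK.
  rewrite mulmxDl mulmxBl.
  by rewrite scaler_nat mulr2n addrA subrK.
rewrite mulmxDl mulmxBl -addrA => /addrI /eqP.
rewrite addrC -subr_eq opprK -mulr2n -scaler_nat => /eqP.
have two_neq0 : 2%:R != 0 :> R by rewrite pnatr_eq0.
move=> /(scalerI two_neq0) ->.
by rewrite addrC addKr.
Qed.

Theorem theorem3p3 (R : realType) (n : nat) (A B Omega : 'M[R]_n)
    (b : 'cV[R]_n) (omega mu_min mu_max tau : R)
    (hA : symmetric_posdef A)
    (homega : 0 < omega)
    (hOmega : Omega = omega%:M)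
    (hmin : is_min_eigenvalue A mu_min)
    (hmax : is_max_eigenvalue A mu_max)
    (htau : tau = spectral_norm B)
    (htau_lt : tau < mu_min)
    (homega_gt : (mu_max - mu_min) / 2%:R + tau < omega) :
  exists xstar : 'cV[R]_n,
    unique (gave_solution A B b) xstar /\
    forall x0 : 'cV[R]_n,
      (exists x : nat -> 'cV[R]_n,
          x 0%N = x0 /\ ssmn_sequence Omega A B b x) /\
      (forall x : nat -> 'cV[R]_n,
          x 0%N = x0 -> ssmn_sequence Omega A B b x ->
          x k @[k --> \oo] --> xstar).
Proof.
have symA := dot_symmetricmx hA.1.
have [eig_min lb_eig] := hmin; have [_ ub_eig] := hmax.
have tau0 : 0 <= tau by rewrite htau spectral_norm_ge0.
have [m' [m'0 m'm m'o m'M q_cond]] :=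
  exists_lower_spectral_bound tau0 htau_lt (ub_eig _ eig_min) homega_gt.
have mu0 : 0 < mu_min by lra.
have uA : omega%:M + A \in unitmx := addmx_shift_unitmx homega mu0 lb_eig.
pose q := (omega - m') / (omega + m') + 2%:R * tau / (omega + mu_min).
have om'0 : 0 < omega + m' by lra.
have om0 : 0 < omega + mu_min by lra.
have q0 : 0 <= q.
  by rewrite addr_ge0 // divr_ge0 ?mulr_ge0 //; lra.
have q1 : q < 1.
  have -> : q = 1 - 2%:R * (m' * (omega + mu_min) - tau * (omega + m'))
                  / ((omega + m') * (omega + mu_min)).
    by rewrite /q; field; rewrite !gt_eqF.
  by rewrite gtrBl divr_gt0 ?mulr_gt0 // subr_gt0.
pose G := ssmn_map A B omega b.
have contrG x y : norm2 (G x - G y) <= q * norm2 (x - y).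
  apply: (norm2_shift_splitting_le symA homega m'0 m'm m'o m'M lb_eig ub_eig
    (e := B *m (abs_vec x - abs_vec y))).
    rewrite mulmxBr !mulKVmx // opprD addrACA -mulmxBr -scalerBr.
    by rewrite opprD addrACA subrr addr0 -mulmxBr.
  apply: le_trans (norm2_mulmx_le _ _) _.
  by rewrite -htau ler_wpM2l // norm2_abs_vecB.
have [p Gp] := norm2_contraction_fixpoint q0 q1 contrG.
exists p; split.
  split=> [|y /(gave_solution_fixpoint _ _ _ uA) Gy].
    exact/(gave_solution_fixpoint _ _ _ uA).
  apply/eqP; rewrite -subr_eq0; apply/eqP/norm2_eq0.
  have := contrG p y; rewrite Gp /G Gy; have := norm2_ge0 (p - y); nra.
move=> x0; split.
  exists (fun k => iter k G x0); split=> // k; rewrite hOmega.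
  exact/(ssmn_mapP _ _ _ _ uA).
move=> x _ xS; apply: (norm2_contraction_cvg q0 q1 contrG Gp) => k.
by apply/(ssmn_mapP _ _ _ _ uA); rewrite -hOmega.
Qed.
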